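(* Let $K$ be an algebraically closed field which is not absolutely algebraic, let $n\geq1$ and let $X_1,\ldots,X_n$ be indeterminates over $K$; put $T=K[X_1,\ldots,X_n]$. Then for each prime ideal $Q$ of $T$ with $n-1\leq \mathrm{ht}(Q)\leq n$, there exists a maximal subring $S$ of $T$ which is integrally closed in $T$ with $(S:T)=Q$.
   Context: All rings are commutative with $1\neq0$ and subrings are unital. A field is absolutely algebraic if it is algebraic over $\mathbb{F}_p$ for some prime $p$. A maximal subring of $T$ is a proper subring maximal with respect to inclusion among proper subrings of $T$. The conductor is $(S:T)=\{x\in T\mid Tx\subseteq S\}$. *)

(* Defs.v *)
From HB Require Import structures.
From mathcomp Require Import all_boot all_order all_algebra.
From mathcomp Require Import mpoly.
Set Implicit Arguments. Unset Strict Implicit. Unset Printing Implicit Defensive.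
Import GRing.Theory.
Local Open Scope ring_scope.

Section Defs.
Variable T : comRingType.

Definition is_subring (S : T -> Prop) : Prop :=
  [/\ S 1, (forall x y, S x -> S y -> S (x - y)) & (forall x y, S x -> S y -> S (x * y))].

Definition proper_subset (S : T -> Prop) : Prop := exists x, ~ S x.

Definition maximal_subring (S : T -> Prop) : Prop :=
  [/\ is_subring S, proper_subset S &
      forall S', is_subring S' -> proper_subset S' ->
        (forall x, S x -> S' x) -> (forall x, S' x -> S x)].

Definition integral_over (S : T -> Prop) (x : T) : Prop :=
  exists p : {poly T}, [/\ p \is monic, (forall i, S p`_i) & root p x].

Definition integrally_closed_in (S : T -> Prop) : Prop :=
  forall x, integral_over S x -> S x.

Definition conductor (S : T -> Prop) : T -> Prop :=
  fun x => forall t : T, S (t * x).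

Definition is_ideal (I : T -> Prop) : Prop :=
  [/\ I 0, (forall x y, I x -> I y -> I (x + y)) & (forall t x, I x -> I (t * x))].

Definition prime_ideal (P : T -> Prop) : Prop :=
  [/\ is_ideal P, ~ P 1 & forall x y, P (x * y) -> P x \/ P y].

Definition height_ge (Q : T -> Prop) (m : nat) : Prop :=
  exists c : nat -> T -> Prop,
    [/\ (forall i, (i <= m)%N -> prime_ideal (c i)),
        (forall i, (i < m)%N ->
           (forall x, c i x -> c i.+1 x) /\ exists x, c i.+1 x /\ ~ c i x) &
        (forall x, c m x <-> Q x)].

End Defs.

(* K is absolutely algebraic: of characteristic p for some prime p and every
   element is algebraic over the prime field F_p = { m%:R | m : nat } of K. *)
Definition absolutely_algebraic (K : fieldType) : Prop :=
  exists p : nat, [/\ prime p, p \in [pchar K] &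
    forall x : K, exists q : {poly K},
      [/\ q != 0, (forall i, exists m : nat, q`_i = m%:R) & root q x]].

(* Main.v *)
Require Import Defs.
From HB Require Import structures.
From mathcomp Require Import all_boot all_order all_algebra.
From mathcomp Require Import mpoly.
From mathcomp Require Import ring zify.
From mathcomp Require boolp classical_sets.

(* Let w be a nonzero scalar of K with inverse t. A subring S of T containing t and
   maximal among those that avoid w behaves like a valuation ring: y z in S implies that y or z
   lies in S, so S is integrally closed, and every larger subring contains w. Hence
   S is a maximal subring as soon as S[w] = T, and the proof consists in choosing,
   before Zorn's lemma is applied, a ring R0 avoiding w such that S[w] = T and
   (S : T) = Q are forced on every such S above R0.

   Since K is not absolutely algebraic, it is algebraic over a ring D which is
   either Z, with t = 2, or L[t], with L a subfield maximal for t being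
   transcendental over it. If all of T is algebraic over K modulo Q, then
   T = K + Q and R0 = D + Q works. Otherwise T/Q has transcendence degree 1; pick x
   transcendental modulo Q and let R0 consist of the g congruent modulo Q to some
   f(x), f in K[X], with f(a_k) in D for all large k, where a_k are the partial sums
   of a t-adic Liouville series. Then x is in S a limit of the a_k, which is not in
   K, so no x - c with c in K is infinitely divisible by t in S, and neither is
   f(x) for f nonzero, because K is algebraically closed. Every y in T satisfies
   F(x, y) in Q for some nonzero F; the leading coefficient of F in y bounds y by a
   power of w, and the trailing one shows that no y outside Q is in the conductor.
   That any two elements are dependent modulo Q follows from the chain of n - 1
   primes below Q: n + 1 elements of T are dependent by counting, and each step of
   the chain eliminates one element. *)
Set Implicit Arguments. Unset Strict Implicit. Unset Printing Implicit Defensive.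
Import GRing.Theory.
Local Open Scope ring_scope.

(** * Subrings maximal among those avoiding an element *)

Section Subrings.
Variables (T : comNzRingType) (S : T -> Prop).
Hypothesis subS : is_subring S.

Lemma subring0 : S 0.
Proof. by case: subS => S1 SB _; rewrite -(subrr 1); exact: SB. Qed.

Lemma subringN x : S x -> S (- x).
Proof. by case: subS => _ SB _ Sx; rewrite -sub0r; apply: (SB) => //; exact: subring0. Qed.

Lemma subringD x y : S x -> S y -> S (x + y).
Proof.
by case: (subS) => _ SB _ Sx Sy; rewrite -(opprK y); apply: (SB) => //; exact: subringN.
Qed.

Lemma subringM x y : S x -> S y -> S (x * y).
Proof. by case: subS => _ _; exact. Qed.

Lemma subringX x n : S x -> S (x ^+ n).
Proof.
move=> Sx; elim: n => [|n IH]; first by rewrite expr0; case: subS.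
by rewrite exprS; exact: subringM.
Qed.

Lemma subring_sum (I : Type) (r : seq I) (P : pred I) (F : I -> T) :
  (forall i, P i -> S (F i)) -> S (\sum_(i <- r | P i) F i).
Proof. by move=> SF; apply: big_ind => //; [exact: subring0|exact: subringD]. Qed.

Lemma subring_coefM (p q : {poly T}) :
  (forall i, S p`_i) -> (forall i, S q`_i) -> forall i, S (p * q)`_i.
Proof. by move=> Sp Sq i; rewrite coefM; apply: subring_sum => j _; exact: subringM. Qed.

Lemma subring_horner (p : {poly T}) x : (forall i, S p`_i) -> S x -> S p.[x].
Proof.
move=> Sp Sx; rewrite horner_coef; apply: subring_sum => i _.
by apply: subringM => //; exact: subringX.
Qed.

Lemma subring_adjoin y :
  is_subring (fun z => exists2 p : {poly T}, forall i, S p`_i & p.[y] = z).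
Proof.
have [S1 SB _] := subS; split.
- by exists 1 => [i|]; rewrite ?hornerC // coef1; case: eqP => _ //=; exact: subring0.
- move=> _ _ [p Sp <-] [q Sq <-]; exists (p - q); last by rewrite !hornerE.
  by move=> i; rewrite coefB; exact: SB.
- move=> _ _ [p Sp <-] [q Sq <-]; exists (p * q); last by rewrite !hornerE.
  exact: subring_coefM.
Qed.

(** This is the preimage in [T] of the localization of [S] at [u]. It serves with [u = 1 + t * s],
    with [u = t], and for inverting constants. *)
Lemma subring_saturate u :
  S u -> is_subring (fun z => exists k, S (u ^+ k * z)).
Proof.
have [S1 SB SM] := subS; move=> Su; split.
- by exists 0; rewrite expr0 mulr1.
- move=> x y [k Sx] [l Sy]; exists (k + l)%N.
  have -> : u ^+ (k + l) * (x - y) = u ^+ l * (u ^+ k * x) - u ^+ k * (u ^+ l * y).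
    by rewrite exprD; ring.
  by apply: (SB); apply: (SM) => //; exact: subringX.
- move=> x y [k Sx] [l Sy]; exists (k + l)%N.
  by rewrite exprD mulrACA; exact: SM.
Qed.

End Subrings.

(* Stands in for a Manis valuation with ring [S]. *)
Definition compl_mul_closed (T : comNzRingType) (S : T -> Prop) :=
  forall y z, S (y * z) -> S y \/ S z.

Section MultClosedComplement.
Variables (T : comNzRingType) (S : T -> Prop).
Hypotheses (subS : is_subring S) (SV : compl_mul_closed S).

(** Horner's scheme: for [p = p1 * 'X + c] the product [p1.[y] * y] lies in [S], so [y] or [p1.[y]]
    does, and one descends to the leading coefficient. *)
Lemma lead_coef_mul_mem (p : {poly T}) y :
  (1 < size p)%N -> (forall i, S p`_i) -> S p.[y] -> S y \/ S (lead_coef p * y).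
Proof.
elim/poly_ind: p => [|p c IH]; first by rewrite size_poly0.
rewrite size_MXaddC; case: eqP => [-> |/eqP p0 /=]; first by rewrite size_poly0; case: ifP.
rewrite ltnS => sp Spc Sh.
have Sp i : S p`_i by have := Spc i.+1; rewrite coefD coefMX coefC /= addr0.
have Sc : S c by have := Spc 0; rewrite coefD coefMX coefC /= add0r.
have lE : lead_coef (p * 'X + c%:P) = lead_coef p.
  rewrite lead_coefDl ?lead_coefMX // size_mulX //.
  by apply: leq_ltn_trans (size_polyC_leq1 c) _.
rewrite lE.
have Spy : S (p.[y] * y).
  have -> : p.[y] * y = (p * 'X + c%:P).[y] - c by rewrite !hornerE; ring.
  by case: subS => _ SB _; exact: SB.
move: sp; rewrite leq_eqVlt => /orP[/eqP sp|sp]; last first.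
  by case: (SV Spy) => Spy'; [exact: IH|left].
right; move: Spy; rewrite (size1_polyC (_ : size p <= 1)%N) -?sp //.
by rewrite hornerC lead_coefC.
Qed.

Lemma compl_mul_closed_integrally_closed : integrally_closed_in S.
Proof.
move=> y [p [mp Sp /rootP py]].
have := @lead_coef_mul_mem p y; rewrite (monicP mp) mul1r py.
case/(_ _ Sp (subring0 subS)) => //; rewrite ltnNge; apply/negP => sp.
move: mp py; rewrite (size1_polyC sp) monicE lead_coefC => /eqP ->.
by rewrite hornerC => /eqP; rewrite oner_eq0.
Qed.

End MultClosedComplement.

Definition maximal_avoiding (T : comNzRingType) (S : T -> Prop) (w : T) :=
  forall S', is_subring S' -> (forall x, S x -> S' x) -> ~ S' w -> forall x, S' x -> S x.

Section MaximalAvoiding.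
Variables (T : comNzRingType) (t w : T) (S : T -> Prop).
Hypotheses (tw : t * w = 1) (subS : is_subring S) (St : S t) (Sw : ~ S w).
Hypothesis maxS : maximal_avoiding S w.

Lemma mem_overring S' : is_subring S' -> (forall x, S x -> S' x) ->
  (exists2 y, S' y & ~ S y) -> S' w.
Proof.
move=> sS' SS' [y S'y Sy]; apply: boolp.contrapT => S'w.
by apply: Sy; exact: (maxS sS' SS' S'w).
Qed.

(** As [t * w = 1], each power of [1 + t * s] has the form [1 + t * r] and sends [w] to [w + r],
    outside [S]. So saturating [S] at [1 + t * s] still avoids [w] and adds nothing. *)
Lemma mem_cancel_1Dmul s y : S s -> S ((1 + t * s) * y) -> S y.
Proof.
move=> Ss Sy; have [S1 SB SM] := subS.
have Su : S (1 + t * s) by apply: subringD => //; exact: SM.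
apply: (maxS (subring_saturate subS Su)) => [x Sx||]; first by exists 0; rewrite mul1r.
- case=> k; suff [r Sr ->] : exists2 r, S r & (1 + t * s) ^+ k = 1 + t * r.
    have -> : (1 + t * r) * w = w + r by rewrite mulrDl mul1r mulrAC tw mul1r.
    by move=> Swr; apply: Sw; rewrite -(addrK r w); exact: SB.
  elim: k => [|k [r Sr IH]]; first by exists 0; [exact: subring0|rewrite mulr0 addr0].
  exists (r + s * (1 + t * r)); last by rewrite exprS IH; ring.
  by apply: subringD => //; apply: (SM) => //; apply: subringD => //; exact: SM.
- by exists 1%N; rewrite expr1.
Qed.

(* If [w] is a polynomial of degree [m] in [y] and one of degree [l <= m] in
   [z], the relation in [z] multiplied by [y ^+ m] lowers the degree in [y]. *)
Lemma degree_descent y z m l (p q : {poly T}) :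
  (forall i, S p`_i) -> (forall i, S q`_i) ->
  (size p <= m.+1)%N -> (size q <= l.+1)%N -> (l <= m)%N ->
  p.[y] = w -> q.[z] = w -> S (y * z) ->
  exists p' : {poly T}, [/\ forall i, S p'`_i, (size p' <= m)%N & p'.[y] = w].
Proof.
move=> Sp Sq sp sq lm py qz Syz; have [S1 SB SM] := subS.
(* Let [q0] be the constant term of [q]. Multiplying [t * q.[z] = 1] by [y ^+ m] gives [(1 - t * q0)
   * y ^+ m = t * g.[y]], with [g] of degree below [m]. *)
pose r := \poly_(i < m) p`_i.
pose g := \sum_(j < l) (q`_j.+1 * (y * z) ^+ j.+1)%:P * 'X^(m.-1 - j).
case: m => [|m] in sp lm r g *.
  move: lm sq qz; rewrite leqn0 => /eqP -> sq qz.
  by case: Sw; rewrite -qz (size1_polyC sq) hornerC.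
(* At [y] this is [q0 + (1 - t * q0) * p.[y]], which equals [w] because [p.[y] = w] and
   [t * w = 1]. *)
exists ((q`_0)%:P + (1 - t * q`_0) *: r + (p`_m.+1 * t) *: g); split.
- move=> i; rewrite !coefD !coefZ coefC coef_poly coef_sum.
  apply: subringD => //; first apply: subringD => //.
  + by case: eqP => _ //; exact: subring0.
  + by case: ifP => _; rewrite ?mulr0; [|exact: subring0];
       apply: (SM) => //; apply: (SB) => //; exact: SM.
  + apply: (SM); first exact: SM; apply: subring_sum => // j _.
    rewrite coefCM coefXn; apply: (SM); first by apply: (SM) => //; exact: subringX.
    by case: eqP => _; [|exact: subring0].
- rewrite -addrA; apply: leq_trans (size_polyD _ _) _; rewrite geq_max.
  rewrite (leq_trans (size_polyC_leq1 _)) //=.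
  apply: leq_trans (size_polyD _ _) _; rewrite geq_max.
  rewrite !(leq_trans (size_scale_leq _ _)) ?size_poly //.
  apply: leq_trans (size_sum _ _ _) _; apply/bigmax_leqP => j _.
  rewrite mul_polyC; apply: leq_trans (size_scale_leq _ _) _.
  by rewrite size_polyXn /=; lia.
have pE : w = r.[y] + p`_m.+1 * y ^+ m.+1.
  rewrite -py horner_poly (horner_coef_wide _ sp) big_ord_recr /=.
  by congr (_ + _); apply: eq_bigr => i _; rewrite coef_poly ltn_ord.
have gE : t * g.[y] = (1 - t * q`_0) * y ^+ m.+1.
  rewrite -tw -qz (horner_coef_wide _ sq) big_ord_recl /= expr0 mulr1.
  rewrite mulrDr [t * q`_0 + _]addrC addrK -mulrA; congr (t * _).
  rewrite mulr_suml horner_sum; apply: eq_bigr => j _.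
  rewrite !hornerE exprMn /bump add1n.
  have -> : y ^+ m.+1 = y ^+ j.+1 * y ^+ (m - j).
    by rewrite -exprD; congr (_ ^+ _); have := ltn_ord j; lia.
  ring.
rewrite !hornerE -[p`_m.+1 * t * _]mulrA gE.
rewrite mulrCA -addrA -mulrDr -pE mulrBl mul1r mulrAC tw; ring.
Qed.

(** If neither factor lies in [S], then [w] is a polynomial over [S] in each of them. The descent
    lowers the larger degree bound until [w] is constant, hence in [S]. *)
Lemma maximal_compl_mul_closed : compl_mul_closed S.
Proof.
move=> y z Syz; apply: boolp.contrapT => /boolp.not_orP[Sy Sz].
have adj v : ~ S v -> exists m (p : {poly T}),
    [/\ forall i, S p`_i, (size p <= m.+1)%N & p.[v] = w].
  move=> Sv; have [||p Sp pv] := @mem_overring _ (subring_adjoin subS v).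
  - move=> x Sx; exists x%:P; last by rewrite hornerC.
    by move=> i; rewrite coefC; case: eqP => _ //; exact: subring0.
  - exists v => //; exists 'X; last by rewrite hornerX.
    by move=> i; rewrite coefX; case: eqP => _; [case: subS|exact: subring0].
  - by exists (size p), p.
have [m [p [Sp sp py]]] := adj y Sy; have [l [q [Sq sq qz]]] := adj z Sz.
have [k] := ubnP (m + l).
elim: k m l p q y z Syz Sy Sz Sp sp py Sq sq qz => // k IH m l p q y z Syz Sy Sz.
wlog lm : m l p q y z Syz Sy Sz / (l <= m)%N => [H|] Sp sp py Sq sq qz mlk.
  have [lm|/ltnW ml] := leqP l m; first exact: (H m l p q y z).
  by apply: (H l m q p z y _ Sz Sy ml) => //; [rewrite mulrC|rewrite addnC].
have [p' [Sp' sp' py']] := degree_descent Sp Sq sp sq lm py qz Syz.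
case: m => [|m] in sp lm sp' mlk *.
  by case: Sw; move: sp'; rewrite leqn0 size_poly_eq0 -py' => /eqP ->;
     rewrite horner0; exact: subring0.
by apply: (IH m l p' q y z) => //; rewrite addSn ltnS in mlk.
Qed.

End MaximalAvoiding.

(** * Zorn's lemma above a given subset *)

Lemma Zorn_extension (U : Type) (P : (U -> Prop) -> Prop) (A0 : U -> Prop) :
  P A0 ->
  (forall F : (U -> Prop) -> Prop, (exists X, F X) -> (forall X, F X -> P X) ->
    (forall X Y, F X -> F Y -> (forall x, X x -> Y x) \/ (forall x, Y x -> X x)) ->
    P (fun x => exists2 X, F X & X x)) ->
  exists A, [/\ P A, forall x, A0 x -> A x &
    forall A', P A' -> (forall x, A x -> A' x) -> forall x, A' x -> A x].
Proof.
move=> PA0 chainP.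
pose ext X := P X /\ forall x, A0 x -> X x.
(* the empty set is added because [Zorn_bigcup] also covers empty chains *)
have [F Fext Fchain|A [PA maxA]] :=
    @classical_sets.Zorn_bigcup U (fun X => (forall x, ~ X x) \/ ext X).
  have [[X [FX extX]]|noF] := boolp.EM (exists X, F X /\ ext X); last first.
    left=> x [X FX Xx]; case: (Fext X FX) => [/(_ x)//|extX].
    by apply: noF; exists X.
  right.
  have -> : classical_sets.bigcup F id = (fun x => exists2 X, F X /\ ext X & X x).
    apply: boolp.funext => x; apply: boolp.propext; split=> -[Y].
      2: by case=> FY _; exists Y.
    move=> FY Yx; exists Y => //; split=> //.
    by case: (Fext Y FY) => [/(_ x)//|].
  split; last by move=> x A0x; exists X => //; case: extX => _; exact.
  apply: chainP; first by exists X.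
  - by move=> Y [_ []].
  - by move=> Y Z [FY _] [FZ _]; exact: Fchain.
have maxA' A' : ext A' -> (forall x, A x -> A' x) -> forall x, A' x -> A x.
  move=> extA' AA'; apply: boolp.contrapT => A'A; apply: (maxA A'); last by right.
  by split.
have [PAA A0A] : ext A.
  case: PA => // A_empty; suff -> : A = A0 by [].
  apply: boolp.funext => x; apply: boolp.propext; split=> [/A_empty//|].
  by apply: maxA'; [|move=> y /A_empty].
exists A; split=> // A' PA' AA'; apply: maxA' => //; split=> // x A0x.
exact/AA'/A0A.
Qed.

Lemma subring_union (T : comNzRingType) (F : (T -> Prop) -> Prop) :
  (exists X, F X) -> (forall X, F X -> is_subring X) ->
  (forall X Y, F X -> F Y -> (forall x, X x -> Y x) \/ (forall x, Y x -> X x)) ->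
  is_subring (fun x => exists2 X, F X & X x).
Proof.
move=> [X0 FX0] subF chainF.
have join x y : (exists2 X, F X & X x) -> (exists2 X, F X & X y) ->
    exists2 X, F X & X x /\ X y.
  move=> [X FX Xx] [Y FY Yy]; case: (chainF X Y FX FY) => sXY.
    by exists Y => //; split=> //; exact: sXY.
  by exists X => //; split=> //; exact: sXY.
split; first by exists X0 => //; case: (subF X0 FX0).
  move=> x y Fx Fy; have [X FX [Xx Xy]] := join x y Fx Fy.
  by exists X => //; case: (subF X FX) => _ + _; apply.
move=> x y Fx Fy; have [X FX [Xx Xy]] := join x y Fx Fy.
by exists X => //; case: (subF X FX) => _ _; apply.
Qed.

Lemma maximal_avoiding_exists (T : comNzRingType) (R0 : T -> Prop) (w : T) :
  is_subring R0 -> ~ R0 w ->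
  exists S, [/\ is_subring S, forall x, R0 x -> S x, ~ S w & maximal_avoiding S w].
Proof.
move=> subR0 R0w.
have [//|F F0 FP Fch|S [[subS Sw] R0S maxS]] :=
    @Zorn_extension T (fun X => is_subring X /\ ~ X w) R0.
  split; first by apply: subring_union => // X /FP[].
  by move=> [X /FP[]].
by exists S; split=> // S' subS' SS' S'w; exact: maxS.
Qed.

(** * A small base ring over which the field is algebraic *)

(* [B N] is the set of elements of size at most [N]; for [D = Z] and [t = 2] the
   size is the binary length, for [D = L[t]] it is the degree in [t] plus one.
   The ring [D] has residue field [D / tD] and is separated for the [t]-adic
   topology. *)
Record sized_base (K : fieldType) (D : K -> Prop) (B : nat -> K -> Prop) (t : K)
    : Prop := SizedBase {
  sb_subring : is_subring D;
  sb_gen : D t;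
  sb_residue : forall d, D d -> (exists2 s, D s & d = t * s) \/
    (exists v s, [/\ D v, D s & d * v = 1 + t * s]);
  sb_algebraic : forall y, exists p : {poly K},
    [/\ p != 0, forall i, D p`_i & root p y];
  sb_size : forall d, D d -> exists N, B N d;
  sb_size0 : forall N, B N 0;
  sb_sizeD : forall M N c d, B M c -> B N d -> B (M + N)%N (c + d);
  sb_sizeM : forall M N c d, B M c -> B N d -> B (M + N)%N (c * d);
  sb_sizeX : forall e, B e.+1 (t ^+ e);
  sb_separated : forall N d, D d -> B N (t ^+ N * d) -> d = 0 }.

Section SizedBase.
Variables (K : fieldType) (D : K -> Prop) (B : nat -> K -> Prop) (t : K).
Hypothesis sbD : sized_base D B t.
Let subD := sb_subring sbD.

Lemma sized_base_gen_neq0 : t != 0.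
Proof.
apply/eqP => t0; have [D1 _ _] := subD.
have := @sb_separated _ _ _ _ sbD 1 1 D1; rewrite t0 expr1 mul0r.
by move=> /(_ (sb_size0 sbD _))/eqP; rewrite oner_eq0.
Qed.
Let t0 := sized_base_gen_neq0.

Lemma sized_base_invN : ~ D t^-1.
Proof.
move=> Dt; have [D1 _ _] := subD; have [N BN] := sb_size sbD D1.
have := @sb_separated _ _ _ _ sbD N (t^-1 ^+ N) (subringX subD N Dt).
rewrite -exprMn divff // expr1n => /(_ BN)/eqP.
by rewrite expf_eq0 invr_eq0 (negPf t0) andbF.
Qed.

Lemma sb_size_le M N d : (M <= N)%N -> B M d -> B N d.
Proof.
move=> MN Bd; rewrite -(subnKC MN) -(addr0 d); apply: (sb_sizeD sbD) => //.
exact: (sb_size0 sbD _).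
Qed.

Lemma sb_size_coef (p : {poly K}) : (forall i, D p`_i) -> exists c, forall i, B c p`_i.
Proof.
move=> Dp; suff [c Bc] : exists c, forall i, (i < size p)%N -> B c p`_i.
  exists c => i; have [/Bc//|ip] := ltnP i (size p).
  by rewrite nth_default //; exact: (sb_size0 sbD _).
elim: (size p) => [|n [c IH]]; first by exists 0%N.
have [N BN] := sb_size sbD (Dp n); exists (c + N)%N => i.
rewrite ltnS leq_eqVlt => /predU1P[->|/IH Bi].
  exact: (sb_size_le (leq_addl _ _) BN).
exact: (sb_size_le (leq_addr _ _) Bi).
Qed.

Lemma sb_size_horner (p : {poly K}) a c x :
  (forall i, B c p`_i) -> B a x -> B (size p * (a + c)) p.[x].
Proof.
elim/poly_ind: p => [|p d IH] Bc Ba; first by rewrite horner0; exact: (sb_size0 sbD _).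
have Bd : B c d by have := Bc 0; rewrite coefD coefMX coefC /= add0r.
have Bp i : B c p`_i by have := Bc i.+1; rewrite coefD coefMX coefC /= addr0.
rewrite size_MXaddC !hornerE; case: ifP => [/andP[/eqP -> /eqP ->]|_].
  by rewrite horner0 mul0r addr0; exact: (sb_size0 sbD _).
apply: (@sb_size_le (size p * (a + c) + a + c)); first by rewrite mulSn; lia.
by do 2?[apply: (sb_sizeD sbD) => //|apply: (sb_sizeM sbD) => //]; exact: IH.
Qed.

(** Splitting off factors [t] stops within [N] steps, [N] bounding the size of [d]: a multiple of
    [t ^+ N] of size at most [N] is 0. *)
Lemma sized_base_factor d : D d -> d != 0 ->
  exists k u v s, [/\ d = t ^+ k * u, D v, D s & u * v = 1 + t * s].
Proof.
move=> Dd d0; have [N BN] := sb_size sbD Dd.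
have : (exists k u v s, [/\ d = t ^+ k * u, D v, D s & u * v = 1 + t * s])
    \/ exists2 d', D d' & d = t ^+ N * d'.
  elim: (N) => [|M [IH|[d' Dd' dE]]]; [|by left|].
    by right; exists d; rewrite ?mul1r.
  have [[s Ds d'E]|[v [s [Dv Ds vE]]]] := sb_residue sbD Dd'.
    by right; exists s; rewrite // exprSr -mulrA -d'E.
  by left; exists M, d', v, s.
case=> // -[d' Dd' dE]; move: BN d0; rewrite dE => BN.
by rewrite (sb_separated sbD Dd' BN) mulr0 eqxx.
Qed.

(* Partial sums of a Liouville-type series: [liouville_size k] bounds the size of
   the [k]-th partial sum, and the next exponent outgrows every fixed multiple
   of it. *)
Fixpoint liouville_size k : nat :=
  if k is k'.+1 then liouville_size k' + (k' * (liouville_size k' + k')).+1 else 0.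
Definition liouville_exp k := (k * (liouville_size k + k))%N.
Definition liouville_sum k := \sum_(j < k) t ^+ liouville_exp j.

Lemma liouville_sum_size k : B (liouville_size k) (liouville_sum k).
Proof.
rewrite /liouville_sum; elim: k => [|k IH]; first by rewrite big_ord0; exact: (sb_size0 sbD _).
by rewrite big_ord_recr; apply: (sb_sizeD sbD) => //; exact: (sb_sizeX sbD _).
Qed.

Lemma liouville_sum_mem k : D (liouville_sum k).
Proof.
apply: (@subring_sum _ D subD) => j _.
apply: (subringX subD); exact: (sb_gen sbD).
Qed.

Lemma liouville_exp_lt k m : (k < m)%N -> (liouville_exp k < liouville_exp m)%N.
Proof.
elim: m => // m IH; rewrite ltnS leq_eqVlt => /predU1P[->|/IH/ltn_trans]; last apply.
all: rewrite /liouville_exp /=; nia.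
Qed.

(** All later exponents exceed [liouville_exp k], so the first omitted term can be factored out with
    a cofactor that is 1 modulo [t]. *)
Lemma liouville_sum_tail k m : (k < m)%N ->
  exists2 d, D d & liouville_sum m = liouville_sum k + t ^+ liouville_exp k * (1 + t * d).
Proof.
elim: m => // m IH; rewrite ltnS leq_eqVlt => /predU1P[->|km].
  exists 0; first exact: (subring0 subD).
  by rewrite mulr0 addr0 mulr1 /liouville_sum big_ord_recr.
have [d Dd mE] := IH km.
exists (d + t ^+ (liouville_exp m - liouville_exp k).-1).
  by apply: (subringD subD) => //; exact: (subringX subD _ (sb_gen sbD)).
have eE : t ^+ liouville_exp m =
    t ^+ liouville_exp k * (t * t ^+ (liouville_exp m - liouville_exp k).-1).
  have := liouville_exp_lt km.
  by rewrite -exprS -exprD => ?; congr (_ ^+ _); lia.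
rewrite {1}/liouville_sum big_ord_recr /= -/(liouville_sum m) mE eE; ring.
Qed.

Lemma liouville_sum_neq k m : (k < m)%N -> liouville_sum m != liouville_sum k.
Proof.
move=> km; have [d Dd ->] := liouville_sum_tail km.
rewrite -subr_eq0 addrAC subrr add0r mulf_neq0 ?expf_neq0 //.
apply/eqP => td; apply: sized_base_invN.
have -> : t^-1 = - d; last exact: (subringN subD Dd).
apply: (mulfI t0); rewrite divff // mulrN; apply/eqP.
by rewrite -subr_eq0 opprK td.
Qed.

Lemma liouville_sum_inj : injective liouville_sum.
Proof.
move=> k m E; have [/liouville_sum_neq|/liouville_sum_neq|//] := ltngtP k m.
all: by rewrite E eqxx.
Qed.

End SizedBase.
(** * The maximal subring *)

Lemma subring_horner_sub (K : comNzRingType) (S : K -> Prop) (p : {poly K}) a b :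
  is_subring S -> (forall i, S p`_i) -> S a -> S b ->
  exists2 h, S h & p.[a] - p.[b] = (a - b) * h.
Proof.
move=> subS + Sa Sb; elim/poly_ind: p => [|p c IH] Sp.
  by exists 0; rewrite ?horner0 ?subrr ?mulr0 //; exact: subring0.
have {}Sp i : S p`_i by have := Sp i.+1; rewrite coefD coefMX coefC /= addr0.
have [h Sh hE] := IH Sp; exists (h * a + p.[b]).
  by apply: subringD => //; [exact: subringM|exact: subring_horner].
rewrite !hornerE mulrDr mulrA -hE; ring.
Qed.

Section MaximalSubring.
Variables (K : closedFieldType) (D : K -> Prop) (B : nat -> K -> Prop) (t : K).
Hypothesis sbD : sized_base D B t.
Variables (T : comNzRingType) (phi : {rmorphism K -> T}) (S : T -> Prop).
Hypotheses (subS : is_subring S) (DS : forall d, D d -> S (phi d)).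
Hypotheses (Sw : ~ S (phi t^-1)) (maxS : maximal_avoiding S (phi t^-1)).

Let subD := sb_subring sbD.
Let t0 : t != 0 := sized_base_gen_neq0 sbD.

Let tw : phi t * phi t^-1 = 1.
Proof. by rewrite -rmorphM divff // rmorph1. Qed.

Let St : S (phi t). Proof. exact: (DS (sb_gen sbD)). Qed.

Let SV : compl_mul_closed S := maximal_compl_mul_closed tw subS St Sw maxS.

(** Passing from [D] to [S] creates no new divisibility by [t]: if [d' * v = 1 + t * s] and [d' / t]
    is in [S], then so is [t^-1 = v * (d' / t) - s]. *)
Lemma mem_pow_dvd e d : D d -> S (phi (d / t ^+ e)) -> exists2 d', D d' & d = t ^+ e * d'.
Proof.
move=> Dd; elim: e => [|e IH] Sd; first by exists d; rewrite ?mul1r.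
have [|d' Dd' dE] := IH.
  have -> : d / t ^+ e = t * (d / t ^+ e.+1).
    by rewrite exprS; field; rewrite t0 expf_neq0.
  by rewrite rmorphM; exact: subringM.
case: (sb_residue sbD Dd') => [[s Ds d'E]|[v [s [Dv Ds vE]]]].
  by exists s; rewrite // exprSr -mulrA -d'E.
case: Sw; have -> : t^-1 = v * (d / t ^+ e.+1) - s.
  have -> : s = (d' * v - 1) / t by rewrite vE; field.
  by rewrite dE exprS; field; rewrite t0 expf_neq0.
rewrite rmorphB rmorphM; case: (subS) => _ SB _.
by apply: SB; [apply: subringM => //; exact: DS|exact: DS].
Qed.

(** Since [phi t] is invertible in [T], this is the ring generated by [S] and [phi t^-1]. *)
Definition bounded y := exists N, S (phi t ^+ N * y).

Lemma bounded_subring : is_subring bounded.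
Proof. exact: subring_saturate. Qed.

Lemma mem_bounded y : S y -> bounded y.
Proof. by exists 0%N; rewrite mul1r. Qed.

Lemma bounded_compl_mul_closed : compl_mul_closed bounded.
Proof.
move=> y z [N]; rewrite mulrA => /SV[Sy|Sz]; [by left; exists N|right].
exact: mem_bounded.
Qed.

Lemma bounded_exprV e : bounded (phi (t ^- e)).
Proof.
exists e; rewrite -rmorphXn -rmorphM divff ?expf_neq0 // rmorph1.
by case: subS.
Qed.

(** With [d = t ^+ k * u] and [u * v = 1 + t * s], the inverse is [t ^- k * v / (1 + t * s)], and
    [1 + t * s] is a unit of [S]. *)
Lemma bounded_invD d : D d -> d != 0 -> bounded (phi d^-1).
Proof.
move=> Dd d0; have [k [u [v [s [dE Dv Ds uv]]]]] := sized_base_factor sbD Dd d0.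
have u0 : u != 0 by apply: contraNneq d0 => u0; rewrite dE u0 mulr0.
have ts0 : 1 + t * s != 0.
  apply/eqP => ts; apply: (sized_base_invN sbD).
  have -> : t^-1 = - s; last exact: (subringN subD Ds).
  by apply: (mulfI t0); rewrite divff // mulrN; apply/eqP; rewrite -subr_eq0 opprK ts.
have Suv : S (phi (1 + t * s)^-1).
  apply: (mem_cancel_1Dmul tw subS St Sw maxS (DS Ds)).
  rewrite -(rmorphM phi t s) -(rmorph1 phi) -rmorphD -rmorphM divff // rmorph1.
  by case: subS.
have -> : d^-1 = t ^- k * (v * (1 + t * s)^-1).
  have v0 : v != 0 by apply: contraNneq ts0 => v0; rewrite -uv v0 mulr0.
  by rewrite dE -uv; field; rewrite u0 v0 expf_neq0.
rewrite rmorphM; apply: (subringM bounded_subring); first exact: bounded_exprV.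
by rewrite rmorphM; apply: mem_bounded; apply: subringM => //; exact: DS.
Qed.

(** A relation of [c] over [D] bounds its leading coefficient times [c], and that coefficient has a
    bounded inverse. *)
Lemma bounded_scalar c : bounded (phi c).
Proof.
have [p [p0 Dp /rootP pc]] := sb_algebraic sbD c.
have Dl : D (lead_coef p) by exact: Dp.
have l0 : lead_coef p != 0 by rewrite lead_coef_eq0.
have sp : (1 < size p)%N.
  rewrite ltnNge; apply/negP => sp; move: p0 pc; rewrite (size1_polyC sp) hornerC.
  by rewrite polyC_eq0 => /negPf p0 /eqP; rewrite p0.
have := @lead_coef_mul_mem _ _ bounded_subring bounded_compl_mul_closed
  (map_poly phi p) (phi c).
rewrite size_map_poly lead_coef_map horner_map pc => /(_ sp); case=> //.
- by move=> i; rewrite coef_map; apply: mem_bounded; exact: DS.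
- by rewrite rmorph0; apply: subring0 bounded_subring.
rewrite -rmorphM => bl; rewrite -(mulKf l0 c) rmorphM.
by apply: (subringM bounded_subring) => //; exact: bounded_invD.
Qed.

Lemma maximal_of_bounded : (forall y, bounded y) -> maximal_subring S.
Proof.
move=> Sb; split=> //; first by exists (phi t^-1).
move=> S' subS' [z S'z] SS'; apply: boolp.contrapT => /boolp.existsNP[y].
move=> /boolp.not_implyP[S'y Sy]; apply: S'z.
have S'w : S' (phi t^-1).
  by apply: (mem_overring maxS subS' SS'); exists y.
have [N Sz] := Sb z.
have -> : z = phi t^-1 ^+ N * (phi t ^+ N * z).
  by rewrite mulrA -exprMn [_ * phi t]mulrC tw expr1n mul1r.
by apply: (subringM subS'); [exact: subringX|exact: SS'].
Qed.

Lemma integrally_closed_of_maximal : integrally_closed_in S.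
Proof. exact: compl_mul_closed_integrally_closed. Qed.

(** * Limits of the Liouville sums *)

Section Transcendental.
Variable x : T.
Hypothesis x_dense : forall k,
  S ((x - phi (liouville_sum t k)) * phi (t ^- liouville_exp k)).

Let Sx : S x.
Proof.
have := x_dense 0; rewrite /liouville_sum big_ord0 /liouville_exp mul0n.
by rewrite expr0 invr1 rmorph0 rmorph1 subr0 mulr1.
Qed.

(* Liouville's argument: if [gamma] were a limit of the partial sums, then for a
   relation [G] of [gamma] over [D] the values of [G] at the partial sums would be
   divisible by powers of [t] exceeding their size, hence eventually zero. *)
Lemma liouville_not_limit gamma : exists N, ~ S ((x - phi gamma) * phi (t ^- N)).
Proof.
apply: boolp.contrapT => limN.
have {limN} lim N : S ((x - phi gamma) * phi (t ^- N)).
  by apply: boolp.contrapT => SN; apply: limN; exists N.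
have [G [G0 DG /rootP Gg]] := sb_algebraic sbD gamma.
have [c Bc] := sb_size_coef sbD DG.
have Sg : S (phi gamma).
  have := lim 0; rewrite expr0 invr1 rmorph1 mulr1 => Sxg.
  by rewrite -(subKr x (phi gamma)); case: (subS) => _ SB _; exact: SB.
have subK : is_subring (fun a => S (phi a)).
  have [S1 SB SM] := subS; split; first by rewrite rmorph1.
    by move=> a b Sa Sb; rewrite rmorphB; exact: SB.
  by move=> a b Sa Sb; rewrite rmorphM; exact: SM.
have Groot k : (size G <= k)%N -> (c <= k)%N -> root G (liouville_sum t k).
  move=> Gk ck; apply/rootP.
  have Dk := liouville_sum_mem sbD k.
  have DGk : D G.[liouville_sum t k] by exact: subring_horner.
  have [h Sh hE] : exists2 h, S (phi h) &
      G.[liouville_sum t k] - G.[gamma] = (liouville_sum t k - gamma) * h.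
    by apply: (subring_horner_sub subK) => // [i|]; exact: DS.
  have [|d' Dd' dE] := @mem_pow_dvd (liouville_exp k) _ DGk.
    rewrite -(subr0 G.[_]) -Gg hE mulrAC rmorphM.
    apply: subringM => //; rewrite rmorphM rmorphB.
    (* Both [gamma] and the partial sum approximate [x] modulo [t ^+ liouville_exp k]. *)
    have -> : phi (liouville_sum t k) - phi gamma =
      (x - phi gamma) - (x - phi (liouville_sum t k)) by ring.
    by rewrite mulrBl; case: (subS) => _ SB _; apply: SB.
  (* The value has size at most [size G * (liouville_size k + c)], hence at most [liouville_exp k],
     so the divisibility makes it vanish. *)
  rewrite dE (@sb_separated _ _ _ _ sbD (liouville_exp k) d' Dd') ?mulr0 // -dE.
  apply: (sb_size_le sbD) (sb_size_horner sbD Bc (liouville_sum_size sbD k)).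
  by rewrite /liouville_exp leq_mul // leq_add.
(* These are [size G] distinct roots of [G], more than its degree. *)
pose r := [seq liouville_sum t (size G + c + i) | i <- iota 0 (size G)].
have /max_poly_roots : G != 0 by [].
move=> /(_ r); rewrite size_map size_iota ltnn.
have -> : all (root G) r.
  by apply/allP => _ /mapP[i _ ->]; apply: Groot; lia.
rewrite map_inj_uniq ?iota_uniq => [/(_ isT isT)//|i j /(liouville_sum_inj sbD)].
by move/addnI.
Qed.

(** [f] splits into linear factors, each outside [S] after division by some power of [t]; elements
    outside [S] have their products outside [S]. The leading coefficient costs one more power of
    [t]. *)
Lemma liouville_eval_not_limit (f : {poly K}) : f != 0 ->
  exists N, ~ S ((map_poly phi f).[x] * phi (t ^- N)).
Proof.
move=> f0; have [r fE] := closed_field_poly_normal f.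
have [N SN] : exists N,
    ~ S ((map_poly phi (\prod_(z <- r) ('X - z%:P))).[x] * phi (t ^- N)).
  elim: (r) => [|z s [N SN]].
    by exists 1%N; rewrite big_nil rmorph1 hornerC mul1r expr1.
  have [M SM] := liouville_not_limit z; exists (M + N)%N.
  rewrite big_cons rmorphM rmorphB /= map_polyX map_polyC /= !hornerE exprD invfM.
  by rewrite rmorphM mulrACA => /SV[].
have l0 : lead_coef f != 0 by rewrite lead_coef_eq0.
have [M Sl] := bounded_scalar (lead_coef f)^-1.
exists (M + N)%N => Sf; apply: SN.
rewrite fE map_polyZ /= hornerZ in Sf; move: Sf.
set g := (X in phi _ * X * _) => Sf.
have -> : g * phi (t ^- N) = phi t ^+ M * phi (lead_coef f)^-1 *
     (phi (lead_coef f) * g * phi (t ^- (M + N))).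
  have -> : t ^- N = t ^+ M * ((lead_coef f)^-1 * lead_coef f) * t ^- (M + N).
    by rewrite exprD; field; rewrite !expf_neq0 // l0.
  by rewrite !rmorphM rmorphXn /=; ring.
exact: subringM.
Qed.

(** The product of [f(x) * t ^- N], outside [S], and [t ^+ (N + M) * y] is [t ^+ M * f(x) * y], in
    [S]; so the second factor is in [S]. *)
Lemma bounded_eval_cancel (f : {poly K}) y : f != 0 ->
  bounded ((map_poly phi f).[x] * y) -> bounded y.
Proof.
move=> f0 [M SM]; have [N SN] := liouville_eval_not_limit f0; exists (N + M)%N.
have : S ((map_poly phi f).[x] * phi (t ^- N) * (phi t ^+ (N + M) * y)).
  set g := (X in X * phi _ * _) in SM *.
  have -> : g * phi (t ^- N) * (phi t ^+ (N + M) * y) = phi t ^+ M * (g * y).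
    have -> : phi t ^+ M = phi (t ^- N) * phi t ^+ (N + M).
      by rewrite -!rmorphXn -rmorphM exprD mulKf // expf_neq0.
    by ring.
  by [].
by case/SV.
Qed.

End Transcendental.
End MaximalSubring.
(** While the constant term of [F] is 0, a factor [y] cancels because [P] is prime; the first
    nonzero one is [g]. *)
Lemma trailing_relation (A T : comNzRingType) (phi : {rmorphism A -> T})
    (P : T -> Prop) (F : {poly A}) y :
  prime_ideal P -> F != 0 -> P (map_poly phi F).[y] -> ~ P y ->
  exists (g : A) (h : T), g != 0 /\ P (phi g + h * y).
Proof.
move=> [_ _ Pmul] + + Py; elim/poly_ind: F => [|F c IH]; first by rewrite eqxx.
rewrite rmorphD rmorphM /= map_polyX map_polyC !hornerE => F0.
have [/eqP c0|c0 PF] := boolP (c == 0); last by exists c, (map_poly phi F).[y]; rewrite addrC.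
rewrite c0 raddf0 addr0 => /Pmul[|//]; apply: IH.
by apply: contraNneq F0 => ->; rewrite mul0r add0r c0.
Qed.

(** * Ideals, and the subring attached to a prime ideal *)

Section Ideals.
Variables (T : comNzRingType) (Q : T -> Prop).
Hypothesis idQ : is_ideal Q.

Lemma ideal0 : Q 0. Proof. by case: idQ. Qed.

Lemma idealD x y : Q x -> Q y -> Q (x + y). Proof. by case: idQ => _ + _; exact. Qed.

Lemma idealMl x y : Q y -> Q (x * y). Proof. by case: idQ => _ _; exact. Qed.

Lemma idealMr x y : Q x -> Q (x * y). Proof. by rewrite mulrC; exact: idealMl. Qed.

Lemma idealB x y : Q x -> Q y -> Q (x - y).
Proof. by move=> Qx Qy; apply: idealD => //; rewrite -mulN1r; exact: idealMl. Qed.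

End Ideals.

Section Existence.
Variables (K : closedFieldType) (D : K -> Prop) (B : nat -> K -> Prop) (t : K).
Hypothesis sbD : sized_base D B t.
Variables (T : comNzRingType) (phi : {rmorphism K -> T}) (Q : T -> Prop).
Hypothesis prQ : prime_ideal Q.

Let subD := sb_subring sbD.
Let t0 : t != 0 := sized_base_gen_neq0 sbD.
Let idQ : is_ideal Q. Proof. by case: prQ. Qed.

Lemma prime_ideal_scalar c : Q (phi c) -> c = 0.
Proof.
move=> Qc; have [//|c0] := eqVneq c 0; have [_ Q1 _] := prQ; case: Q1.
by rewrite -(rmorph1 phi) -(mulVf c0) rmorphM; exact: idealMl.
Qed.

Lemma residue_field_case : (forall y, exists c, Q (y - phi c)) ->
  exists S, [/\ maximal_subring S, integrally_closed_in S &
    forall y, conductor S y <-> Q y].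
Proof.
move=> QK.
pose R0 g := exists2 d, D d & Q (g - phi d).
have subR0 : is_subring R0.
  have [D1 DB DM] := subD; split.
  - by exists 1 => //; rewrite rmorph1 subrr; exact: (ideal0 idQ).
  - move=> g h [c Dc Qc] [d Dd Qd]; exists (c - d); first exact: DB.
    have -> : g - h - phi (c - d) = (g - phi c) - (h - phi d) by rewrite rmorphB; ring.
    exact: idealB.
  - move=> g h [c Dc Qc] [d Dd Qd]; exists (c * d); first exact: DM.
    have -> : g * h - phi (c * d) = (g - phi c) * h + phi c * (h - phi d).
      by rewrite rmorphM; ring.
    by apply: (idealD idQ); [exact: idealMr|exact: idealMl].
have R0w : ~ R0 (phi t^-1).
  move=> [d Dd]; rewrite -rmorphB => /prime_ideal_scalar/eqP.
  rewrite subr_eq0 => /eqP tE; apply: (sized_base_invN sbD); by rewrite tE.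
have [S [subS R0S Sw maxS]] := maximal_avoiding_exists subR0 R0w.
have DS d : D d -> S (phi d).
  by move=> Dd; apply: R0S; exists d; rewrite // subrr; exact: (ideal0 idQ).
have QS q : Q q -> S q.
  by move=> Qq; apply: R0S; exists 0; rewrite ?rmorph0 ?subr0 //; exact: subring0.
exists S; split.
- apply: (maximal_of_bounded sbD subS Sw maxS) => y; have [c Qc] := QK y.
  rewrite -(subrK (phi c) y); apply: (subringD (bounded_subring sbD subS DS)).
    by exists 0%N; rewrite mul1r; exact: QS.
  exact: (bounded_scalar sbD subS DS Sw maxS c).
- exact: (integrally_closed_of_maximal sbD subS DS Sw maxS).
- move=> y; split=> [Sy|Qy z]; last exact/QS/(idealMl idQ).
  have [c Qc] := QK y; have [c0|c0] := eqVneq c 0.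
    by rewrite c0 rmorph0 subr0 in Qc.
  (* A multiple of [y], in [S] by the conductor condition, is congruent to [phi t^-1] modulo [Q],
     and [Q] is contained in [S]. *)
  case: Sw; have -> : phi t^-1 =
      phi (t * c)^-1 * y - phi (t * c)^-1 * (y - phi c).
    by rewrite -mulrBr subKr -rmorphM; congr (phi _); field; rewrite t0 c0.
  by case: (subS) => _ SB _; apply: SB => //; exact/QS/(idealMl idQ).
Qed.

Variable x : T.

Notation eval := (horner_morph (fun c => mulrC x (phi c))).

Lemma curve_case :
  (forall f : {poly K}, Q (eval f) -> f = 0) ->
  (forall y, exists2 F : {poly {poly K}}, F != 0 & Q (map_poly eval F).[y]) ->
  exists S, [/\ maximal_subring S, integrally_closed_in S &
    forall y, conductor S y <-> Q y].
Proof.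
move=> Qtr Qalg.
pose R0 g := exists f : {poly K}, Q (g - eval f) /\
  exists k0, forall k, (k0 <= k)%N -> D f.[liouville_sum t k].
have subR0 : is_subring R0.
  have [D1 DB DM] := subD; split.
  - exists 1; split; first by rewrite rmorph1 subrr; exact: (ideal0 idQ).
    by exists 0%N => k _; rewrite hornerC.
  - move=> g h [f1 [Q1 [k1 D1f]]] [f2 [Q2 [k2 D2f]]]; exists (f1 - f2); split.
      have -> : g - h - eval (f1 - f2) = (g - eval f1) - (h - eval f2).
        by rewrite rmorphB; ring.
      exact: idealB.
    exists (maxn k1 k2) => k; rewrite geq_max => /andP[lk1 lk2].
    by rewrite !hornerE; apply: DB; [exact: D1f|exact: D2f].
  - move=> g h [f1 [Q1 [k1 D1f]]] [f2 [Q2 [k2 D2f]]]; exists (f1 * f2); split.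
      have -> : g * h - eval (f1 * f2) = (g - eval f1) * h + eval f1 * (h - eval f2).
        by rewrite rmorphM; ring.
      by apply: (idealD idQ); [exact: idealMr|exact: idealMl].
    exists (maxn k1 k2) => k; rewrite geq_max => /andP[lk1 lk2].
    by rewrite !hornerE; apply: DM; [exact: D1f|exact: D2f].
have evalC c : eval c%:P = phi c by rewrite /horner_morph map_polyC hornerC.
have evalX : eval 'X = x by rewrite /horner_morph map_polyX hornerX.
have R0w : ~ R0 (phi t^-1).
  (* Since [eval] is injective modulo [Q], [f] is the constant [t^-1], whose values would lie in
     [D]. *)
  move=> [f [Qf [k0 Dk]]]; apply: (sized_base_invN sbD).
  have := Dk _ (leqnn k0); move: Qf; rewrite -evalC -rmorphB => /Qtr/eqP.
  by rewrite subr_eq0 => /eqP <-; rewrite hornerC.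
have [S [subS R0S Sw maxS]] := maximal_avoiding_exists subR0 R0w.
have DS d : D d -> S (phi d).
  move=> Dd; apply: R0S; exists d%:P; rewrite evalC subrr; split; first exact: ideal0.
  by exists 0%N => k _; rewrite hornerC.
have QS q : Q q -> S q.
  move=> Qq; apply: R0S; exists 0; rewrite rmorph0 subr0; split=> //.
  by exists 0%N => k _; rewrite horner0; exact: subring0.
have x_dense k : S ((x - phi (liouville_sum t k)) * phi (t ^- liouville_exp k)).
  (* This polynomial is 0 at the [k]-th sum and has a value [1 + t * d] at each later one. *)
  apply: R0S; exists (('X - (liouville_sum t k)%:P) * (t ^- liouville_exp k)%:P).
  rewrite rmorphM rmorphB /= evalX !evalC subrr; split; first exact: ideal0.
  exists k => m; rewrite leq_eqVlt !hornerE => /predU1P[->|km].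
    by rewrite subrr mul0r; exact: subring0.
  have [d Dd ->] := liouville_sum_tail sbD km.
  rewrite addrAC subrr add0r mulrC mulKf ?expf_neq0 //.
  by apply: (subringD subD); [case: subD|apply: (subringM subD) => //; exact: (sb_gen sbD)].
have subB := bounded_subring sbD subS DS.
have evalB f : bounded t phi S (eval f).
  apply: (subring_horner subB) => [i|].
    by rewrite coef_map; exact: (bounded_scalar sbD subS DS Sw maxS _).
  apply: mem_bounded; have := x_dense 0.
  rewrite /liouville_sum big_ord0 /liouville_exp mul0n.
  by rewrite expr0 invr1 rmorph0 rmorph1 subr0 mulr1.
have eval_neq0 f : f != 0 -> eval f != 0.
  by move=> f0; apply/eqP => ef; move: f0; rewrite (Qtr f) ?eqxx // ef; exact: ideal0.
exists S; split.
- apply: (maximal_of_bounded sbD subS Sw maxS) => y; have [F F0 QF] := Qalg y.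
  have lF0 : lead_coef F != 0 by rewrite lead_coef_eq0.
  have sF : size (map_poly eval F) = size F by rewrite size_map_poly_id0 ?eval_neq0.
  have := @lead_coef_mul_mem _ _ subB (bounded_compl_mul_closed sbD subS DS Sw maxS)
    (map_poly eval F) y.
  rewrite sF lead_coef_map_id0 ?rmorph0 ?eval_neq0 //; case.
  + rewrite ltnNge; apply/negP => sF1; move: F0 QF; rewrite (size1_polyC sF1).
    by rewrite map_polyC hornerC => F0 /Qtr F00; rewrite F00 eqxx in F0.
  + by move=> i; rewrite coef_map; exact: evalB.
  + by apply/mem_bounded/QS.
  + by [].
  + exact: (bounded_eval_cancel sbD subS DS Sw maxS x_dense lF0).
- exact: (integrally_closed_of_maximal sbD subS DS Sw maxS).
- move=> y; split=> [Sy|Qy z]; last exact/QS/(idealMl idQ).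
  apply: boolp.contrapT => Qy; have [F F0 QF] := Qalg y.
  have [g [h [g0 Qg]]] := trailing_relation prQ F0 QF Qy.
  have [N] := liouville_eval_not_limit sbD subS DS Sw maxS x_dense g0; apply.
  (* The first term is in [Q], the second in [S] because [y] is in the conductor. *)
  have -> : (map_poly phi g).[x] * phi (t ^- N) =
      phi (t ^- N) * (eval g + h * y) - (phi (t ^- N) * h) * y.
    by rewrite /horner_morph; ring.
  by case: (subS) => _ SB _; apply: SB => //; exact/QS/(idealMl idQ).
Qed.

End Existence.
(** * Existence of the base ring *)

Definition prime_subring (K : nzRingType) (d : K) : Prop := exists m : int, d = m%:~R.

Lemma prime_subringP (K : comNzRingType) : is_subring (@prime_subring K).
Proof.
split; first by exists 1.
  by move=> _ _ [m ->] [n ->]; exists (m - n); rewrite rmorphB.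
by move=> _ _ [m ->] [n ->]; exists (m * n); rewrite rmorphM.
Qed.

Lemma sized_base_int (K : fieldType) :
  [pchar K] =i pred0 ->
  (forall y : K, exists p : {poly K},
     [/\ p != 0, forall i, prime_subring p`_i & root p y]) ->
  sized_base (@prime_subring K)
    (fun N d => exists2 m : int, (`|m| < 2 ^ N)%N & d = m%:~R) 2%:R.
Proof.
move=> /pcharf0P charK Kalg.
have int_eq0 (m : int) : m%:~R = 0 :> K -> m = 0.
  by case: m => n; rewrite ?NegzE ?mulrNz => /eqP; rewrite ?oppr_eq0 charK => /eqP ->.
split=> //.
- exact: prime_subringP.
- by exists 2%:Z.
- move=> _ [m ->]; have [k [mE|mE]] : exists k : int, m = 2%:Z * k \/ m = 1 + 2%:Z * k.
    by exists (intdiv.divz m 2); lia.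
  + by left; exists k%:~R; [exists k|rewrite mE rmorphM].
  + right; exists 1, k%:~R; split; [by exists 1|by exists k|].
    by rewrite mulr1 mE rmorphD rmorphM.
- by move=> _ [m ->]; exists `|m|%N, m => //; exact: ltn_expl.
- by move=> N; exists 0; rewrite // expn_gt0.
- move=> M N _ _ [m lm ->] [n ln ->]; exists (m + n); last by rewrite rmorphD.
  have : (`|(m + n)%R| <= `|m| + `|n|)%N by lia.
  rewrite expnD; nia.
- move=> M N _ _ [m lm ->] [n ln ->]; exists (m * n); last by rewrite rmorphM.
  by rewrite abszM expnD ltn_mul.
- move=> e; exists (2%:Z ^+ e); last by rewrite rmorphXn.
  by rewrite abszX ltn_exp2l.
- move=> N _ [m ->] [n ln mE].
  have {mE} mn : 2%:Z ^+ N * m = n.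
    by apply/eqP; rewrite -subr_eq0; apply/eqP/int_eq0;
       rewrite rmorphB rmorphM rmorphXn /= -mE subrr.
  suff -> : m = 0 by [].
  apply/eqP; rewrite -absz_eq0; apply/negP => m0.
  move: ln; rewrite -mn abszM abszX /= ltnNge => /negP; apply.
  by rewrite leq_pmulr // lt0n; apply/negP.
Qed.

(** * The base ring [L[t]] *)

Definition transcendental_over (K : nzRingType) (L : K -> Prop) (t : K) : Prop :=
  forall p : {poly K}, (forall i, L p`_i) -> root p t -> p = 0.

Lemma chain_coef (K : nzRingType) (F : (K -> Prop) -> Prop) (p : {poly K}) :
  (forall X Y, F X -> F Y -> (forall x, X x -> Y x) \/ (forall x, Y x -> X x)) ->
  (forall X, F X -> X 0) -> (exists X, F X) ->
  (forall i, exists2 X, F X & X p`_i) -> exists2 X, F X & forall i, X p`_i.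
Proof.
move=> chF F0 [X0 FX0] Fp.
suff [X FX Xp] : exists2 X, F X & forall i, (i < size p)%N -> X p`_i.
  exists X => // i; have [/Xp//|ip] := ltnP i (size p).
  by rewrite nth_default //; exact: F0.
elim: (size p) => [|n [X FX IH]]; first by exists X0.
have [Y FY Yn] := Fp n; case: (chF X Y FX FY) => sXY.
  by exists Y => // i; rewrite ltnS leq_eqVlt => /predU1P[->//|/IH/sXY].
by exists X => // i; rewrite ltnS leq_eqVlt => /predU1P[->|/IH//]; exact: sXY.
Qed.

Section FunctionField.
Variables (K : fieldType) (t : K) (L : K -> Prop).
Hypotheses (subL : is_subring L) (trL : transcendental_over L t).
Hypothesis maxL : forall L', is_subring L' -> transcendental_over L' t ->
  (forall x, L x -> L' x) -> forall x, L' x -> L x.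

(** Adjoining [c^-1] keeps [t] transcendental, by clearing denominators with a power of [c];
    maximality then makes [L] a field. *)
Lemma maximal_transcendental_inv c : L c -> c != 0 -> L c^-1.
Proof.
move=> Lc c0; have [L1 _ _] := subL.
apply: (maxL (subring_saturate subL Lc)) => [p Lp pt|x Lx|].
- have [k Lk] : exists k, forall i, L (c ^+ k * p`_i).
    suff [k Lk] : exists k, forall i, (i < size p)%N -> L (c ^+ k * p`_i).
      exists k => i; have [/Lk//|ip] := ltnP i (size p).
      by rewrite nth_default // mulr0; exact: subring0.
    elim: (size p) => [|n [k IH]]; first by exists 0%N.
    have [l Ll] := Lp n; exists (k + l)%N => i.
    rewrite ltnS leq_eqVlt => /predU1P[->|/IH Lki].
      by rewrite exprD -mulrA; apply: subringM => //; exact: subringX.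
    by rewrite addnC exprD -mulrA; apply: subringM => //; exact: subringX.
  have /eqP : c ^+ k *: p = 0.
    apply: trL => [i|]; first by rewrite coefZ.
    by rewrite /root hornerZ (rootP pt) mulr0.
  by rewrite scaler_eq0 expf_eq0 (negPf c0) andbF => /eqP.
- by exists 0%N; rewrite mul1r.
- by exists 1%N; rewrite expr1 divff.
Qed.

Definition adjoin_gen (d : K) := exists2 q : {poly K}, forall i, L q`_i & q.[t] = d.

(** For [y] outside [L], maximality yields a relation of [t] over [L[y]]. Read as a polynomial in
    [y], it has coefficients in [L[t]]. *)
Lemma adjoin_gen_algebraic y :
  exists p : {poly K}, [/\ p != 0, forall i, adjoin_gen p`_i & root p y].
Proof.
have [L1 _ _] := subL.
have subD : is_subring adjoin_gen by exact: subring_adjoin.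
have LD c : L c -> adjoin_gen c.
  move=> Lc; exists c%:P => [i|]; last by rewrite hornerC.
  by rewrite coefC; case: eqP => _ //; exact: subring0.
have [Ly|Ly] := boolp.EM (L y).
  exists ('X - y%:P); rewrite polyXsubC_eq0 root_XsubC; split=> // i.
  rewrite coefB coefX coefC; case: (subD) => D1 DB _; apply: DB.
    by case: eqP => _ //=; exact: (subring0 subD).
  by case: eqP => _; [exact: LD|exact: (subring0 subD)].
have : ~ transcendental_over (fun z => exists2 p : {poly K}, forall i, L p`_i & p.[y] = z) t.
  move=> trLy; apply: Ly; apply: (maxL (subring_adjoin subL y) trLy) => [x Lx|].
    exists x%:P => [i|]; last by rewrite hornerC.
    by rewrite coefC; case: eqP => _ //; exact: subring0.
  exists 'X => [i|]; last by rewrite hornerX.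
  by rewrite coefX; case: eqP => _ //=; exact: subring0.
move=> /boolp.existsNP[p] /boolp.not_implyP[Lp] /boolp.not_implyP[/rootP pt /eqP p0].
have adjLp i : exists q : {poly K}, (forall j, L q`_j) /\ q.[y] = p`_i.
  by have [q Lq qy] := Lp i; exists q.
have [q Lq] := boolp.choice adjLp.
pose M := \max_(i < size p) size (q i).
pose c j := \poly_(i < size p) (q i)`_j.
have qM (i : 'I_(size p)) : (size (q i) <= M)%N by exact: (leq_bigmax i).
exists (\poly_(j < M) (c j).[t]); split.
(* If every [(c j).[t]] is 0, transcendence of [t] over [L] kills all [c j], hence all [q i] and
   [p]. *)
- apply: contraNneq p0 => H0; apply/eqP/polyP => i; rewrite coef0.
  have [ip|ip] := ltnP i (size p); last by rewrite nth_default.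
  have [_ <-] := Lq i; suff -> : q i = 0 by rewrite horner0.
  apply/polyP => j; rewrite coef0; have [jM|jM] := ltnP j M; last first.
    by rewrite nth_default // (leq_trans (qM (Ordinal ip))).
  have /(congr1 (fun r : {poly K} => r`_i)) : c j = 0.
    apply: trL => [k|].
      by rewrite coef_poly; case: ifP => _; [case: (Lq k)|exact: subring0].
    by have /(congr1 (fun r : {poly K} => r`_j)) := H0; rewrite coef_poly jM coef0 => /rootP.
  by rewrite coef_poly ip coef0.
- move=> j; rewrite coef_poly; case: ifP => _; last exact: (subring0 subD).
  exists (c j) => // k; rewrite coef_poly.
  by case: ifP => _; [case: (Lq k)|exact: subring0].
- apply/rootP; rewrite -pt horner_poly (horner_coef p).
  under eq_bigr => j _ do rewrite horner_poly mulr_suml.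
  rewrite exchange_big; apply: eq_bigr => i _ /=.
  have [_ <-] := Lq i; rewrite (horner_coef_wide _ (qM i)) mulr_suml.
  by apply: eq_bigr => j _; rewrite mulrAC.
Qed.

Lemma sized_base_function_field :
  sized_base adjoin_gen
    (fun N d => exists q : {poly K}, [/\ forall i, L q`_i, (size q <= N)%N & q.[t] = d]) t.
Proof.
have [L1 LB LM] := subL.
have LXn e i : L ('X^e : {poly K})`_i.
  by rewrite coefXn; case: eqP => _ //=; exact: subring0.
split.
- exact: subring_adjoin.
- by exists 'X; rewrite ?hornerX // => i; have := LXn 1 i; rewrite expr1.
- move=> _ [q + <-]; elim/poly_ind: q => [|q c _] Lqc.
    left; exists 0; last by rewrite horner0 mulr0.
    exact: (subring0 (subring_adjoin subL t)).
  have Lq i : L q`_i by have := Lqc i.+1; rewrite coefD coefMX coefC /= addr0.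
  have Lc : L c by have := Lqc 0; rewrite coefD coefMX coefC /= add0r.
  (* Modulo [t] only the constant term [c] remains, and [L] is a field. *)
  rewrite !hornerE; have [->|c0] := eqVneq c 0.
    by left; exists q.[t]; [exists q|rewrite addr0 mulrC].
  have Lci := maximal_transcendental_inv Lc c0.
  right; exists c^-1, (q * (c^-1)%:P).[t]; split;
    last by rewrite hornerM hornerC mulrDl mulfV //; ring.
    exists (c^-1)%:P => [i|]; last by rewrite hornerC.
    by rewrite coefC; case: eqP => _ //; exact: subring0.
  exists (q * (c^-1)%:P) => // i.
  by rewrite coefMC; exact: subringM.
- exact: adjoin_gen_algebraic.
- by move=> _ [q Lq <-]; exists (size q), q.
- move=> N; exists 0; split=> [i||]; rewrite ?size_poly0 ?horner0 //.
  by rewrite coef0; exact: subring0.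
- move=> M N _ _ [p [Lp sp <-]] [q [Lq sq <-]]; exists (p + q); split.
  + by move=> i; rewrite coefD; exact: subringD.
  + by rewrite (leq_trans (size_polyD _ _)) // geq_max; lia.
  + by rewrite hornerD.
- move=> M N _ _ [p [Lp sp <-]] [q [Lq sq <-]]; exists (p * q); split.
  + exact: subring_coefM.
  + by have := size_polyMleq p q; lia.
  + by rewrite hornerM.
- by move=> e; exists 'X^e; rewrite size_polyXn hornerXn.
- move=> N _ [q Lq <-] [p [Lp sp pE]].
  have /eqP : 'X^N * q - p = 0.
    apply: trL => [i|]; last by rewrite /root !hornerE -pE subrr.
    by rewrite coefB; apply: LB => //; apply: subring_coefM.
  rewrite subr_eq0 => /eqP XE.
  have [->|q0] := eqVneq q 0; first by rewrite horner0.
  move: sp; rewrite -XE mulrC size_mulXn // leqNgt -{1}(addn0 N) ltn_add2l.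
  by rewrite size_poly_gt0 q0.
Qed.

End FunctionField.

Lemma sized_base_exists (K : fieldType) : ~ absolutely_algebraic K ->
  exists D B (t : K), sized_base D B t.
Proof.
move=> Kna.
have [[t trt]|noT] := boolp.EM (exists t : K, transcendental_over (@prime_subring K) t).
  have [||L [[subL trL] _ maxL]] :=
      @Zorn_extension K (fun X => is_subring X /\ transcendental_over X t) (@prime_subring K).
  - by split=> //; exact: prime_subringP.
  - move=> F neF FP chF; split; first by apply: subring_union => // X /FP[].
    move=> p Fp; have [|X FX Xp] := chain_coef chF _ neF Fp.
      by move=> X /FP[subX _]; exact: subring0.
    by have [_] := FP X FX; apply.
  exists (adjoin_gen t L); eexists; exists t; apply: sized_base_function_field => //.
  by move=> L' subL' trL'; apply: maxL.
have Kalg (y : K) : exists p : {poly K},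
    [/\ p != 0, forall i, prime_subring p`_i & root p y].
  apply: boolp.contrapT => noP; apply: noT; exists y => p Pp py.
  by apply/eqP; apply: boolp.contrapT => /negP p0; apply: noP; exists p.
(* Positive characteristic is excluded: [K], algebraic over its prime subring, would be absolutely
   algebraic. *)
exists (@prime_subring K); eexists; exists 2%:R; apply: sized_base_int => // p.
rewrite inE; apply/negP => pK; apply: Kna; exists p.
split=> //; first by case/andP: pK.
move=> x; have [q [q0 Pq qx]] := Kalg x; exists q; split=> // i.
have [m ->] := Pq i; have pr : prime p by case/andP: pK.
case: m => n; first by exists n.
(* A negative integer becomes a natural multiple of 1 because [p.-1] is -1 in [K]. *)
exists (n.+1 * p.-1)%N.
have pE : p.-1%:R = -1 :> K.
  by apply/eqP; rewrite -subr_eq0 opprK natr1 prednK ?prime_gt0 // (pcharf0 pK).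
by rewrite NegzE mulrNz natrM pE mulrN1.
Qed.
(** * Algebraic dependence modulo the members of a chain of primes *)

(* Polynomials in [r] variables, iterated so that the last variable can be split
   off definitionally. *)
Fixpoint iter_poly (K : idomainType) (r : nat) : idomainType :=
  if r is r'.+1 then {poly (iter_poly K r')} : idomainType else K.

Fixpoint iter_eval (K : idomainType) (T : comNzRingType) (phi : {rmorphism K -> T})
    (y : nat -> T) (r : nat) : {rmorphism iter_poly K r -> T} :=
  match r return {rmorphism iter_poly K r -> T} with
  | 0 => phi
  | r'.+1 => horner_morph (fun c => mulrC (y r') (iter_eval phi y r' c))
  end.

Section IteratedPolynomials.
Variables (K : idomainType) (T : comNzRingType) (phi : {rmorphism K -> T}).

Lemma iter_evalS y r (p : {poly (iter_poly K r)}) :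
  iter_eval phi y r.+1 p = (map_poly (iter_eval phi y r) p).[y r].
Proof. by []. Qed.

Lemma eq_iter_eval y z r : (forall i, (i < r)%N -> y i = z i) ->
  iter_eval phi y r =1 iter_eval phi z r.
Proof.
elim: r => // r IH yz p; rewrite !iter_evalS yz //; congr (_.[_]).
by apply: eq_map_poly => c; apply: IH => i ir; apply: yz; exact: ltnW.
Qed.

Variable N : nat.

(* The polynomial with exponents less than [N] whose coefficients are listed by
   [v], an exponent vector being encoded by its base-[N] digits. *)
Fixpoint pack r (v : nat -> K) : iter_poly K r :=
  match r return iter_poly K r with
  | 0 => v 0
  | r'.+1 => \poly_(i < N) pack r' (fun e => v (i * N ^ r' + e)%N)
  end.

(** For [e < N ^ r] the exponent of [y i] is the base-[N] digit of [e] of weight [N ^ i], as in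
    [pack]. *)
Fixpoint monomial (y : nat -> T) r e : T :=
  if r is r'.+1 then monomial y r' (e %% N ^ r')%N * y r' ^+ (e %/ N ^ r')%N else 1.

Lemma pack_eq0 r v : pack r v = 0 -> forall e, (e < N ^ r)%N -> v e = 0.
Proof.
elim: r v => [v v0 [|//] _|r IH v /= v0 e]; first exact: v0.
rewrite expnS => eN; have Nr : (0 < N ^ r)%N by move: eN; case: (N ^ r)%N; rewrite ?muln0.
have iN : (e %/ N ^ r < N)%N by rewrite ltn_divLR.
have /(congr1 (fun q : {poly _} => q`_(e %/ N ^ r)%N)) := v0.
rewrite coef_poly iN coef0 => /IH /(_ (e %% N ^ r)%N).
by rewrite ltn_mod -divn_eq; apply.
Qed.

Lemma iter_eval_pack y r v :
  iter_eval phi y r (pack r v) = \sum_(e < N ^ r) phi (v e) * monomial y r e.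
Proof.
elim: r v => [|r IH] v; first by rewrite expn0 big_ord1 mulr1.
have sz : (size (map_poly (iter_eval phi y r) (pack r.+1 v)) <= N)%N.
  by apply: leq_trans (size_poly _ _) (size_poly _ _).
rewrite iter_evalS (horner_coef_wide _ sz).
rewrite -(big_mkord xpredT (fun e => phi (v e) * monomial y r.+1 e)).
rewrite expnS big_nat_mul big_mkord; apply: eq_bigr => i _.
have -> : (map_poly (iter_eval phi y r) (pack r.+1 v))`_i =
    iter_eval phi y r (pack r (fun e => v (i * N ^ r + e)%N)).
  by rewrite coef_map coef_poly ltn_ord.
rewrite IH mulr_suml.
rewrite -[X in \sum_(X <= _ < _) _]add0n big_addn mulSn addnK big_mkord.
apply: eq_bigr => e _; rewrite /= [(e + _)%N]addnC mulrA.
have Nr : (0 < N ^ r)%N by apply: leq_ltn_trans (ltn_ord e).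
by rewrite modnMDl divnMDl // modn_small // divn_small // addn0.
Qed.

End IteratedPolynomials.

Section Dependence.
Variables (K : fieldType) (n : nat).
Notation T := {mpoly K[n]}.
Notation scalar := (@mpolyC n K : {rmorphism K -> T}).

Lemma msize_mul_leq (p q : T) a b : (msize p <= a.+1)%N -> (msize q <= b.+1)%N ->
  (msize (p * q) <= (a + b).+1)%N.
Proof.
move=> pa qb; have [->|p0] := eqVneq p 0; first by rewrite mul0r msize0.
have [->|q0] := eqVneq q 0; first by rewrite mulr0 msize0.
by rewrite msizeM // -subn1 leq_subLR add1n -addnS -addSn leq_add.
Qed.

Lemma msize_exp_leq (p : T) a k : (msize p <= a.+1)%N -> (msize (p ^+ k) <= (k * a).+1)%N.
Proof.
move=> pa; elim: k => [|k IH]; first by rewrite expr0 msize1.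
by rewrite exprS mulSn; exact: msize_mul_leq.
Qed.

Lemma msize_monomial (y : nat -> T) d N r e :
  (forall i, (i < r)%N -> msize (y i) <= d.+1)%N -> (e < N ^ r)%N ->
  (msize (monomial N y r e) <= (r * (N * d)).+1)%N.
Proof.
elim: r e => [|r IH] e yd; first by rewrite msize1.
rewrite expnS => eN; have Nr : (0 < N ^ r)%N by move: eN; case: (N ^ r)%N; rewrite ?muln0.
have iN : (e %/ N ^ r < N)%N by rewrite ltn_divLR.
rewrite mulSn addnC; apply: msize_mul_leq.
  by apply: IH => [i ir|]; [apply: yd; exact: ltnW|rewrite ltn_mod].
apply: leq_trans (msize_exp_leq _ (yd r (ltnSn r))) _.
by rewrite ltnS leq_mul2r ltnW ?orbT.
Qed.

(* There are more products of bounded exponents than monomials of the degrees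
   they reach. *)
Lemma mpoly_dependent (y : nat -> T) :
  exists2 g : iter_poly K n.+1, g != 0 & iter_eval scalar y n.+1 g = 0.
Proof.
pose d := \max_(i < n.+1) msize (y i).
have yd i : (i < n.+1)%N -> (msize (y i) <= d.+1)%N.
  by move=> ir; apply/leqW/(leq_bigmax (Ordinal ir)).
(* Thus [b] exceeds the degree bound [n.+1 * (N * d)] of the products, and their number [N ^ n.+1]
   exceeds the number [b ^ n = c ^ n * N ^ n] of columns of [A]. *)
pose c := (n.+1 * d).+1; pose N := (c ^ n).+1; pose b := (c * N)%N.
pose mon (f : {ffun 'I_n -> 'I_b}) := [multinom (f i : nat) | i < n].
pose A := \matrix_(e < N ^ n.+1, j < #|{ffun 'I_n -> 'I_b}|)
  (monomial N y n.+1 e)@_(mon (enum_val j)).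
have kerA : kermx A != 0.
  rewrite kermx_eq0 -row_leq_rank -ltnNge; apply: leq_ltn_trans (rank_leq_col _) _.
  by rewrite card_ffun !card_ord /b expnMn expnS ltn_pmul2r ?expn_gt0.
have [v vA v0] := rowV0Pn kerA; move: vA; rewrite sub_kermx => /eqP vA.
pose w e := if insub e is Some i then v 0 i else 0.
have wE (i : 'I_(N ^ n.+1)) : w i = v 0 i by rewrite /w valK.
exists (pack N n.+1 w).
  apply: contraNneq v0 => /pack_eq0 w0; apply/eqP/rowP => i.
  by rewrite mxE -wE w0.
rewrite iter_eval_pack; apply/mpolyP => m; rewrite mcoeff0 raddf_sum /=.
have mcE (e : 'I_(N ^ n.+1)) : ((w e)%:MP * monomial N y n.+1 e)@_m =
    v 0 e * (monomial N y n.+1 e)@_m by rewrite mcoeffCM wE.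
rewrite (eq_bigr _ (fun e _ => mcE e)).
have [mb|bm] := ltnP (mdeg m) b; last first.
  apply: big1 => e _; suff /eqP -> : (monomial N y n.+1 e)@_m == 0 by rewrite mulr0.
  rewrite mcoeff_eq0; apply: msize_mdeg_ge; apply: leq_trans bm.
  apply: leq_trans (msize_monomial yd (ltn_ord e)) _.
  by rewrite /b /c; nia.
have mib i : (m i < b)%N.
  by apply: leq_ltn_trans mb; rewrite mdegE (bigD1 i) //= leq_addr.
pose f := [ffun i => Ordinal (mib i)].
have <- : mon f = m by apply/mnmP => i; rewrite mnmE ffunE.
have /rowP/(_ (enum_rank f)) := vA; rewrite !mxE => {2}<-.
by apply: eq_bigr => e _; rewrite mxE enum_rankK.
Qed.

(** Apply induction to [y] followed by some [x] in [c m.+1] outside [c m]. The trailing relation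
    [g + h * x] in [c m] then puts [g] in [c m.+1]. *)
Lemma chain_dependent (c : nat -> T -> Prop) m :
  (forall i, (i <= m)%N -> prime_ideal (c i)) ->
  (forall i, (i < m)%N ->
     (forall x, c i x -> c i.+1 x) /\ exists x, c i.+1 x /\ ~ c i x) ->
  forall r, (r + m)%N = n.+1 -> forall y : nat -> T,
  exists2 g : iter_poly K r, g != 0 & c m (iter_eval scalar y r g).
Proof.
elim: m => [|m IH] prc incc r rm y.
  rewrite addn0 in rm; rewrite rm; have [g g0 gE] := mpoly_dependent y.
  by exists g; rewrite // gE; apply: ideal0; case: (prc 0).
have [cS [x [cSx cx]]] := incc m (ltnSn m).
pose z i := if (i < r)%N then y i else x.
have [|||G G0] := IH _ _ r.+1 _ z.
- by move=> i im; apply: prc; exact: leqW.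
- by move=> i im; apply: incc; exact: leqW.
- by rewrite addSnnS.
rewrite iter_evalS {2}/z ltnn => cG.
have [g [h [g0 cg]]] := trailing_relation (prc m (leqnSn m)) G0 cG cx.
exists g => //; have [idc _ _] := prc m.+1 (leqnn _).
rewrite (eq_iter_eval _ (z := z)) => [|i ir]; last by rewrite /z ir.
have := idealB idc (cS _ cg) (idealMl idc h cSx).
by rewrite addrK.
Qed.

End Dependence.

(** * The dichotomy modulo [Q] *)

Theorem theorem3p5 (K : closedFieldType) (n : nat) :
  ~ absolutely_algebraic K -> (1 <= n)%N ->
  forall Q : {mpoly K[n]} -> Prop,
    prime_ideal Q -> height_ge Q n.-1 -> ~ height_ge Q n.+1 ->
    exists S : {mpoly K[n]} -> Prop,
      [/\ maximal_subring S, integrally_closed_in S &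
          forall x, conductor S x <-> Q x].
Proof.
move=> Kna n_gt0 Q prQ [c [prc incc cQ]] _.
have [D [B [t sbD]]] := sized_base_exists Kna.
have idQ : is_ideal Q by case: prQ.
pose scalar := @mpolyC n K : {rmorphism K -> {mpoly K[n]}}.
pose eval x : {rmorphism {poly K} -> {mpoly K[n]}} :=
  horner_morph (fun c => mulrC x (scalar c)).
have [[x trx]|algX] :=
    boolp.EM (exists x : {mpoly K[n]}, forall f, Q (eval x f) -> f = 0).
  apply: (curve_case sbD prQ trx) => y.
  (* The chain of length [n.-1] leaves 2 as the number of elements forced to be dependent, since
     [2 + n.-1 = n.+1]. *)
  have [|F F0 /cQ QF] := @chain_dependent K n c n.-1 prc incc 2 _
      (fun i => if i is 0 then x else y).
    by rewrite addSn add1n prednK.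
  by exists F.
apply: (residue_field_case sbD (phi := scalar) prQ) => y.
have [f [Qf f0]] : exists f, Q (eval y f) /\ f <> 0.
  apply: boolp.contrapT => nof; apply: algX; exists y => f Qf.
  by apply: boolp.contrapT => f0; apply: nof; exists f.
have [r fE] := closed_field_poly_normal f.
(* The prime [Q] contains a linear factor [y - z] of this product, so [y] is a scalar modulo [Q]. *)
have : Q (eval y (\prod_(z <- r) ('X - z%:P))).
  have l0 : lead_coef f != 0 by rewrite lead_coef_eq0; apply/eqP.
  have -> : \prod_(z <- r) ('X - z%:P) = (lead_coef f)^-1%:P * f.
    by rewrite mul_polyC {2}fE scalerA mulVf // scale1r.
  by rewrite rmorphM; exact: idealMl.
elim: (r) => [|z s IH].
  by rewrite big_nil rmorph1; case: prQ.
rewrite big_cons rmorphM => Qm; have [_ _ Qmul] := prQ.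
case: (Qmul _ _ Qm) => [Qz|/IH//]; exists z.
by move: Qz; rewrite rmorphB /= /horner_morph map_polyX map_polyC hornerX hornerC.
Qed.
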